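(* For all graphs $G$ and $H$, the distance-numbers of the cartesian product $G\square H$ satisfy \begin{align*} \max\{\mathrm{dn}'(G),\mathrm{dn}'(H)\} &\leq \mathrm{dn}'(G\square H) \leq \mathrm{dn}'(G)+\mathrm{dn}'(H)-1,\\ \max\{\mathrm{dn}(G),\mathrm{dn}(H)\} &\leq \mathrm{dn}(G\square H)\leq\mathrm{dn}(G)+\mathrm{dn}(H)-1. \end{align*}
   Context: The cartesian product $G\square H$ has vertex set $V(G)\times V(H)$, where $(v,w)$ is adjacent to $(p,q)$ iff ($v=p$ and $wq\in E(H)$) or ($w=q$ and $vp\in E(G)$). A degenerate drawing of a graph maps vertices to distinct points in the plane and each edge to the open straight-line segment joining its endpoints; a drawing is a degenerate drawing in which no vertex lies in the interior of an edge. The distance-number $\mathrm{dn}(G)$ (resp. degenerate distance-number $\mathrm{dn}'(G)$) is the minimum number of distinct edge-lengths over all drawings (resp. degenerate drawings) of $G$.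
   Formalization: The graphs G and H are assumed to have nonempty vertex sets, and the two upper bounds are stated only when both G and H have an edge; otherwise the claim fails, e.g. dn(K1□K2)=1 while dn(K1)+dn(K2)-1=0. *)

(* Defs.v *)
From HB Require Import structures.
From mathcomp Require Import all_boot all_order all_algebra.
From mathcomp Require Import boolp classical_sets reals.
From mathcomp Require Import ring lra.

Set Implicit Arguments.
Unset Strict Implicit.
Unset Printing Implicit Defensive.

Import Order.TTheory GRing.Theory Num.Theory.
Local Open Scope ring_scope.
Local Open Scope classical_set_scope.

Record sgraph := SGraph {
  vertex :> finType;
  edge : rel vertex;
  edge_sym : symmetric edge;
  edge_irrefl : irreflexive edge }.

Definition has_edge (G : sgraph) := exists u v : G, edge u v.

Section CartesianProduct.
Variables G H : sgraph.

Definition cart_edge : rel (G * H)%type := fun x y =>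
  ((x.1 == y.1) && edge x.2 y.2) || ((x.2 == y.2) && edge x.1 y.1).

Lemma cart_edge_sym : symmetric cart_edge.
Proof.
move=> x y; rewrite /cart_edge (eq_sym x.1) (eq_sym x.2).
by rewrite (edge_sym x.1) (edge_sym x.2).
Qed.

Lemma cart_edge_irrefl : irreflexive cart_edge.
Proof. by move=> x; rewrite /cart_edge !edge_irrefl !andbF. Qed.

Definition cart_prod : sgraph := SGraph cart_edge_sym cart_edge_irrefl.

End CartesianProduct.

Notation "G □ H" := (cart_prod G H) (at level 40, left associativity).

Section Drawings.
Variable R : realType.

(* Spelled out because the library norm on R * R is the sup norm. *)
Definition eucl_dist (p q : R * R) : R :=
  Num.sqrt ((p.1 - q.1) ^+ 2 + (p.2 - q.2) ^+ 2).

Definition open_segment (p q : R * R) : set (R * R) :=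
  [set (p.1 + t * (q.1 - p.1), p.2 + t * (q.2 - p.2))
    | t in [set t : R | 0 < t < 1]].

Variable G : sgraph.

Definition degenerate_drawing (f : G -> R * R) : Prop := injective f.

Definition drawing (f : G -> R * R) : Prop :=
  degenerate_drawing f /\
  forall u v w : G, edge u v -> ~ open_segment (f u) (f v) (f w).

Definition edge_lengths (f : G -> R * R) : seq R :=
  undup [seq eucl_dist (f e.1) (f e.2)
         | e <- enum {: G * G} & edge e.1 e.2].

Definition drawn_with (P : (G -> R * R) -> Prop) (n : nat) : Prop :=
  exists2 f, P f & size (edge_lengths f) = n.

(* No three points of a parabola are collinear. *)
Lemma drawing_exists : exists f : G -> R * R, drawing f.
Proof.
pose c (v : G) : R := (enum_rank v)%:R.
have c_inj : injective c.
  move=> u v /eqP; rewrite eqr_nat => /eqP uv.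
  exact/enum_rank_inj/val_inj.
exists (fun v => (c v, c v ^+ 2)); split=> [u v [/c_inj] //|u v w uv].
case=> t /andP[t0 t1] [e1 e2].
have cuv : c v - c u != 0.
  by rewrite subr_eq0; apply/eqP => /c_inj vu; rewrite vu edge_irrefl in uv.
have /eqP : t * (1 - t) * (c v - c u) ^+ 2 = 0.
  have e1' : c w = c u + t * (c v - c u) by rewrite -e1.
  have e2' : c w ^+ 2 = c u ^+ 2 + t * (c v ^+ 2 - c u ^+ 2) by rewrite -e2.
  rewrite e1' in e2'.
  have -> : t * (1 - t) * (c v - c u) ^+ 2 =
     c u ^+ 2 + t * (c v ^+ 2 - c u ^+ 2) - (c u + t * (c v - c u)) ^+ 2 by ring.
  by rewrite e2' subrr.
by rewrite !mulf_eq0 (negPf cuv) (gt_eqF t0) orbF subr_eq0 (gt_eqF t1).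
Qed.

Lemma degenerate_drawn_with_ex :
  exists n, `[< drawn_with degenerate_drawing n >].
Proof.
have [f [fi _]] := drawing_exists.
by exists (size (edge_lengths f)); apply/asboolP; exists f.
Qed.

Lemma drawn_with_ex : exists n, `[< drawn_with drawing n >].
Proof.
have [f fd] := drawing_exists.
by exists (size (edge_lengths f)); apply/asboolP; exists f.
Qed.

Definition dn : nat := ex_minn drawn_with_ex.

Definition dn' : nat := ex_minn degenerate_drawn_with_ex.

End Drawings.

(* Main.v *)
Require Import Defs.
From mathcomp Require Import all_boot reals.
From mathcomp Require Import all_order all_algebra.
From mathcomp Require Import boolp.
From mathcomp Require Import ring lra.

(** For the lower bounds, a drawing of [G □ H] restricts to a drawing of each
    copy of [G] and of [H].  For the upper bounds, place [(v, w)] at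
    [f v + M (g w)], where [f] and [g] are optimal drawings and [M] is a
    similarity.  The edge lengths are then those of [f] together with those
    of [g] multiplied by the ratio of [M], and the ratio is chosen so that one
    length is common to both.  Each coincidence of two vertices, and each vertex
    on an edge, forces [cross (M d) e = k] for one of finitely many [d], [e], [k]
    with [d] and [e] nonzero; all but finitely many angles avoid these. *)

Set Implicit Arguments.
Unset Strict Implicit.
Unset Printing Implicit Defensive.

Import Order.TTheory GRing.Theory Num.Theory.
Local Open Scope ring_scope.

(** The naturals embed injectively in [F], and a nonzero [p] has fewer than [size p] roots. *)
Lemma poly_nat_nonroot (F : numDomainType) (p : {poly F}) :
  p != 0 -> exists n : nat, p.[n%:R] != 0.
Proof.
move=> p0; apply: contrapT => noroot.
have : (size [seq n%:R : F | n <- iota 0 (size p)] < size p)%N.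
  apply: max_poly_roots => //; last first.
    by rewrite map_inj_uniq ?iota_uniq // => m n /eqP; rewrite eqr_nat => /eqP.
  apply/allP => _ /mapP[n _ ->]; apply/negPn/negP => pn.
  by apply: noroot; exists n.
by rewrite size_map size_iota ltnn.
Qed.

(** * Similarities of the plane with prescribed ratio in general position *)

Section Similarities.
Variable R : realType.
Implicit Types (p q d e m : R * R) (a b k r t : R).

Definition cross p q : R := p.1 * q.2 - p.2 * q.1.

(* Complex multiplication, hence the similarity of ratio [|m|]. *)
Definition csim m p : R * R :=
  (m.1 * p.1 - m.2 * p.2, m.2 * p.1 + m.1 * p.2).

Lemma cross_csim m d e :
  cross (csim m d) (csim m e) = (m.1 ^+ 2 + m.2 ^+ 2) * cross d e.
Proof. by rewrite /cross /csim /=; ring. Qed.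

Lemma pair_neq0 p : p != 0 -> 0 < p.1 ^+ 2 + p.2 ^+ 2.
Proof.
case: p => a b /= ab; rewrite lt0r addr_ge0 ?sqr_ge0 // andbT.
by rewrite paddr_eq0 ?sqr_ge0 // !sqrf_eq0 -xpair_eqE.
Qed.

(* Numerator of [a x + b y - k] at the point
   [(x, y) = r / (1 + t^2) (1 - t^2, 2 t)] of the circle of radius [r]. *)
Definition circle_poly r a b k : {poly R} :=
  Poly [:: r * a - k; 2 * r * b; - (r * a + k)].

Lemma horner_circle_poly r a b k t :
  (circle_poly r a b k).[t] =
  r * a * (1 - t ^+ 2) + 2 * r * b * t - k * (1 + t ^+ 2).
Proof. by rewrite /circle_poly horner_Poly /=; ring. Qed.

(** A line cannot contain a whole circle: it already misses one of the points [(r, 0)], [(0, r)],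
    [(0, - r)], which are the parameters 0, 1 and -1. *)
Lemma circle_poly_neq0 r a b k :
  r != 0 -> (a, b) != 0 -> circle_poly r a b k != 0.
Proof.
move=> r0 /pair_neq0 /= ab; apply/eqP => p0.
have h (t : R) := horner_circle_poly r a b k t.
have := h 0; have := h 1; have := h (-1); rewrite p0 !horner0 => h1 h2 h3.
have ra : r * a = 0 by lra.
have rb : r * b = 0 by lra.
move/eqP: ra; move/eqP: rb; rewrite !mulf_eq0 (negPf r0) /= => /eqP b0 /eqP a0.
by rewrite a0 b0 expr0n /= addr0 ltxx in ab.
Qed.

Lemma circle_avoiding_lines r (s : seq (R * R * R)) :
  r != 0 -> (forall x, x \in s -> x.1 != 0) ->
  exists2 m : R * R, m.1 ^+ 2 + m.2 ^+ 2 = r ^+ 2 &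
    forall x, x \in s -> x.1.1 * m.1 + x.1.2 * m.2 != x.2.
Proof.
move=> r0 s0.
(* A nonroot of the product is a parameter whose point lies on none of the lines. *)
have P0 : \prod_(x <- s) circle_poly r x.1.1 x.1.2 x.2 != 0.
  rewrite prodf_seq_neq0; apply/allP => x xs /=.
  by apply: circle_poly_neq0 => //; rewrite -surjective_pairing; exact: s0.
have [n] := poly_nat_nonroot P0; set t := n%:R => Pt.
have t1 : 1 + t ^+ 2 != 0 by apply/lt0r_neq0; rewrite ltr_pwDl ?ltr01 ?sqr_ge0.
exists (r * (1 - t ^+ 2) / (1 + t ^+ 2), r * (2 * t) / (1 + t ^+ 2)) => /=.
  by field.
move=> x xs; apply: contra_neq Pt => e.
rewrite horner_prod; apply/eqP; rewrite prodf_seq_eq0; apply/hasP.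
exists x => //=; rewrite horner_circle_poly -e; apply/eqP; field.
by [].
Qed.

(** For fixed [d] and [e], [cross (csim m d) e] is linear in [m], so each forbidden equation is a
    line in the plane of [m], to be avoided on the circle of radius [r]. *)
Lemma generic_similarity r (D E : seq (R * R)) (K : seq R) :
  r != 0 ->
  exists2 m : R * R, m.1 ^+ 2 + m.2 ^+ 2 = r ^+ 2 &
    forall d e k, d \in D -> e \in E -> k \in K -> d != 0 -> e != 0 ->
      cross (csim m d) e != k.
Proof.
move=> r0.
pose line d e k : R * R * R :=
  ((d.1 * e.2 - d.2 * e.1, - (d.1 * e.1 + d.2 * e.2)), k).
pose s := [seq line x.1.1 x.1.2 x.2 | x <- [seq (y, k) | y <-
  [seq (d, e) | d <- D, e <- E], k <- K] & (x.1.1 != 0) && (x.1.2 != 0)].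
have [|m mr ms] := @circle_avoiding_lines r s r0.
  move=> x /mapP[[[d e] k]]; rewrite mem_filter /= => /andP[/andP[d0 e0] _] ->.
  apply/eqP => -[x0 y0].
  have := mulr_gt0 (pair_neq0 d0) (pair_neq0 e0).
  suff -> : (d.1 ^+ 2 + d.2 ^+ 2) * (e.1 ^+ 2 + e.2 ^+ 2) = 0 by rewrite ltxx.
  (* Lagrange's identity: the normal of the line has length [|d| |e|], hence is nonzero. *)
  transitivity ((d.1 * e.2 - d.2 * e.1) ^+ 2 +
    (- (d.1 * e.1 + d.2 * e.2)) ^+ 2); first by ring.
  by rewrite x0 y0 expr0n /= addr0.
exists m => // d e k dD eE kK d0 e0.
have : line d e k \in s.
  apply/mapP; exists ((d, e), k) => //; rewrite mem_filter /= d0 e0 /=.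
  by apply: allpairs_f => //; apply: allpairs_f.
move=> /ms; apply: contra_neq => <-.
by rewrite /cross /csim /=; ring.
Qed.

Lemma eucl_dist_gt0 p q : p != q -> 0 < eucl_dist p q.
Proof. by move=> pq; rewrite sqrtr_gt0 (@pair_neq0 (p - q)) ?subr_eq0. Qed.

Lemma eucl_dist_addr p q d : eucl_dist (p + d) (q + d) = eucl_dist p q.
Proof. by rewrite /eucl_dist /=; congr Num.sqrt; ring. Qed.

Lemma eucl_dist_add_csim r m d p q :
  0 <= r -> m.1 ^+ 2 + m.2 ^+ 2 = r ^+ 2 ->
  eucl_dist (d + csim m p) (d + csim m q) = r * eucl_dist p q.
Proof.
move=> r0 mr; rewrite /eucl_dist /= -[in RHS](ger0_norm r0) -sqrtr_sqr -mr.
by rewrite -sqrtrM ?addr_ge0 ?sqr_ge0 //; congr Num.sqrt; ring.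
Qed.

End Similarities.

(** * Distance-numbers as attained minima *)

Section DistanceNumbers.
Variable R : realType.
Implicit Types G H K : sgraph.

Lemma edge_lengthsP G (f : G -> R * R) (l : R) :
  reflect (exists u v, edge u v /\ l = eucl_dist (f u) (f v))
          (l \in edge_lengths f).
Proof.
rewrite mem_undup; apply: (iffP mapP) => [[[u v]]|[u [v [uv ->]]]].
  by rewrite mem_filter => /andP[uv _] ->; exists u, v.
by exists (u, v); rewrite // mem_filter uv mem_enum.
Qed.

Lemma dn_le G (f : G -> R * R) :
  drawing f -> (dn R G <= size (edge_lengths f))%N.
Proof.
by move=> fd; rewrite /dn; case: ex_minnP => n _; apply; apply/asboolP; exists f.
Qed.

Lemma dn'_le G (f : G -> R * R) :
  degenerate_drawing f -> (dn' R G <= size (edge_lengths f))%N.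
Proof.
by move=> fd; rewrite /dn'; case: ex_minnP => n _; apply; apply/asboolP; exists f.
Qed.

Lemma dn_attained G :
  exists2 f : G -> R * R, drawing f & size (edge_lengths f) = dn R G.
Proof. by rewrite /dn; case: ex_minnP => n /asboolP. Qed.

Lemma dn'_attained G :
  exists2 f : G -> R * R,
    degenerate_drawing f & size (edge_lengths f) = dn' R G.
Proof. by rewrite /dn'; case: ex_minnP => n /asboolP. Qed.

(** * Monotonicity under injective homomorphisms *)

Section Embedding.
Variables (G K : sgraph) (phi : G -> K).
Hypothesis phi_inj : injective phi.
Hypothesis phi_edge : forall u v, edge u v -> edge (phi u) (phi v).

Lemma edge_lengths_embedding (f : K -> R * R) :
  (size (edge_lengths (f \o phi)) <= size (edge_lengths f))%N.
Proof.
apply: uniq_leq_size; first exact: undup_uniq.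
move=> _ /edge_lengthsP[u [v [uv ->]]]; apply/edge_lengthsP.
by exists (phi u), (phi v); split=> //; exact: phi_edge.
Qed.

Lemma dn_embedding : (dn R G <= dn R K)%N.
Proof.
have [f [fi fd] <-] := dn_attained K.
apply: leq_trans (edge_lengths_embedding f); apply: dn_le; split.
  by move=> u v /= /fi /phi_inj.
by move=> u v w /phi_edge; exact: fd.
Qed.

Lemma dn'_embedding : (dn' R G <= dn' R K)%N.
Proof.
have [f fi <-] := dn'_attained K.
apply: leq_trans (edge_lengths_embedding f); apply: dn'_le.
by move=> u v /= /fi /phi_inj.
Qed.

End Embedding.

Lemma cart_edgel G H (w : H) (u v : G) :
  edge u v -> @edge (G □ H) (u, w) (v, w).
Proof. by move=> uv; rewrite /= /cart_edge /= eqxx uv orbT. Qed.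

Lemma cart_edger G H (v : G) (w q : H) :
  edge w q -> @edge (G □ H) (v, w) (v, q).
Proof. by move=> wq; rewrite /= /cart_edge /= eqxx wq. Qed.

Lemma cart_edgeP G H (x y : G □ H) :
  edge x y -> (x.1 = y.1 /\ edge x.2 y.2) \/ (x.2 = y.2 /\ edge x.1 y.1).
Proof. by case/orP => /andP[/eqP]; [left | right]. Qed.

(** * Drawings of the product *)

Section ProductDrawing.
Variables (G H : sgraph) (f : G -> R * R) (g : H -> R * R).
Hypotheses (f_inj : injective f) (g_inj : injective g).

Definition prod_placement (m : R * R) (x : G □ H) : R * R :=
  f x.1 + csim m (g x.2).

(** Along an edge one of the two summands is constant, so the edge is a translate of an edge of [f],
    or of the image under [csim m] of an edge of [g]. *)
Lemma edge_lengths_prod_placement r m :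
  0 <= r -> m.1 ^+ 2 + m.2 ^+ 2 = r ^+ 2 ->
  {subset edge_lengths (prod_placement m) <=
    edge_lengths f ++ [seq r * l | l <- edge_lengths g]}.
Proof.
move=> r0 mr _ /edge_lengthsP[[v w] [[p q] [/cart_edgeP /= xy ->]]].
rewrite mem_cat /prod_placement /=; apply/orP.
case: xy => -[-> e]; [right | left].
  rewrite (eucl_dist_add_csim _ _ _ r0 mr); apply: map_f.
  by apply/edge_lengthsP; exists w, q.
by rewrite eucl_dist_addr; apply/edge_lengthsP; exists v, p.
Qed.

Lemma generic_prod_placement r : r != 0 ->
  exists m : R * R, [/\ m.1 ^+ 2 + m.2 ^+ 2 = r ^+ 2,
    degenerate_drawing (prod_placement m) &
    drawing f -> drawing g -> drawing (prod_placement m)].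
Proof.
move=> r0.
pose D := codom (fun x : H * H => g x.1 - g x.2).
pose E := codom (fun x : G * G => f x.1 - f x.2).
(* If a vertex is at parameter [t] on an edge, taking the cross product with the edge direction
   removes [t]. What remains is a value in [Kf] for edges from [G], in [Kg] for edges from [H]. *)
pose Kf := codom (fun x : G * G * G =>
  cross (f x.1.1 - f x.2) (f x.1.2 - f x.1.1)).
pose Kg := codom (fun x : H * H * H =>
  r ^+ 2 * cross (g x.1.2 - g x.1.1) (g x.1.1 - g x.2)).
have [m mr generic] := generic_similarity D E (0 :: Kf ++ Kg) r0.
have {}generic (w q : H) (v p : G) (k : R) : k \in 0 :: Kf ++ Kg ->
    w != q -> v != p -> cross (csim m (g w - g q)) (f v - f p) <> k.
  move=> kK wq vp; apply/eqP; apply: generic => //.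
  - exact: (codom_f (fun x : H * H => g x.1 - g x.2) (w, q)).
  - exact: (codom_f (fun x : G * G => f x.1 - f x.2) (v, p)).
  - by rewrite subr_eq0 (inj_eq g_inj).
  - by rewrite subr_eq0 (inj_eq f_inj).
have m_neq0 : m.1 ^+ 2 + m.2 ^+ 2 != 0 by rewrite mr expf_eq0.
(* Complex multiplication by the conjugate of [m] turns [csim m d] into [|m|^2 d]. *)
have csim_eq0 d : csim m d = 0 -> d = 0.
  case: d => d1 d2 [e1 e2].
  have h1 : (m.1 ^+ 2 + m.2 ^+ 2) * d1 = 0.
    transitivity (m.1 * (m.1 * d1 - m.2 * d2) + m.2 * (m.2 * d1 + m.1 * d2)).
      by ring.
    by rewrite e1 e2 !mulr0 addr0.
  have h2 : (m.1 ^+ 2 + m.2 ^+ 2) * d2 = 0.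
    transitivity (m.1 * (m.2 * d1 + m.1 * d2) - m.2 * (m.1 * d1 - m.2 * d2)).
      by ring.
    by rewrite e1 e2 !mulr0 subr0.
  move/eqP: h1; move/eqP: h2; rewrite !mulf_eq0 (negPf m_neq0) /=.
  by move=> /eqP -> /eqP ->.
have placement_inj : injective (prod_placement m).
  move=> [v w] [p q] [e1 e2].
  have [wq|wq] := eqVneq w q.
    subst q; congr (_, _); apply: f_inj.
    by apply/eqP; rewrite -pair_eqE /pair_eq; apply/andP; split; apply/eqP;
       [move: e1 | move: e2]; rewrite /= => /addIr.
  have [vp|vp] := eqVneq v p.
    subst p; congr (_, _); apply: g_inj; apply/eqP; rewrite -subr_eq0; apply/eqP.
    apply: csim_eq0; rewrite /csim /=; congr (_, _).
      by move/addrI: e1 => /= e1; rewrite !mulrBr; lra.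
    by move/addrI: e2 => /= e2; rewrite !mulrBr; lra.
  (* Coincident images make the displacements in [f] and in [csim m \o g] opposite, so their cross
     product is 0. *)
  exfalso; apply: (generic w q v p 0) => //; first by rewrite inE eqxx.
  rewrite /cross /csim /= in e1 e2 *.
  have -> : (f v).1 - (f p).1 =
    - (m.1 * ((g w).1 - (g q).1) - m.2 * ((g w).2 - (g q).2)) by lra.
  have -> : (f v).2 - (f p).2 =
    - (m.2 * ((g w).1 - (g q).1) + m.1 * ((g w).2 - (g q).2)) by lra.
  by ring.
exists m; split=> // -[_ f_drawn] [_ g_drawn]; split=> //.
move=> [v w] [p q] [x y] /cart_edgeP /= vwpq [t t01 [e1 e2]].
case: vwpq => -[? e]; [subst p | subst q].
(* Edge in a copy of [H]. A vertex of the same copy would, after cancelling [f v] and [csim m], lie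
   on an edge of [g]; any other vertex is excluded by [Kg]. *)
- have [xv|xv] := eqVneq x v.
    subst x; apply: (g_drawn w q y e); exists t => //.
    set z := (X in X = _); suff : z - g y = 0 by move/eqP; rewrite subr_eq0 => /eqP.
    apply: csim_eq0; rewrite /z /csim /=; rewrite /= in e1 e2.
    by congr (_, _); lra.
  have qw : q != w by apply: contraTneq e => ->; rewrite edge_irrefl.
  apply: (generic q w x v _ _ qw xv _).
    rewrite inE mem_cat; apply/orP; right; apply/orP; right.
    exact: (codom_f (fun x : H * H * H =>
      r ^+ 2 * cross (g x.1.2 - g x.1.1) (g x.1.1 - g x.2)) ((w, q), y)).
  (* The factor [r ^+ 2] in [Kg] is absorbed by applying [csim m] to both arguments of [cross]. *)
  rewrite -mr /= -cross_csim.
  rewrite /cross /csim /= in e1 e2 *.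
  have -> : (f x).1 - (f v).1 =
     (m.1 * ((g w).1 - (g y).1) - m.2 * ((g w).2 - (g y).2))
     + t * (m.1 * ((g q).1 - (g w).1) - m.2 * ((g q).2 - (g w).2)) by lra.
  have -> : (f x).2 - (f v).2 =
     (m.2 * ((g w).1 - (g y).1) + m.1 * ((g w).2 - (g y).2))
     + t * (m.2 * ((g q).1 - (g w).1) + m.1 * ((g q).2 - (g w).2)) by lra.
  by ring.
(* Edge in a copy of [G]: the same dichotomy, with a translation to cancel and [Kf] for the other
   copies. *)
- have [yw|yw] := eqVneq y w.
    subst y; apply: (f_drawn v p x e); exists t => //.
    rewrite [RHS]surjective_pairing; rewrite /= in e1 e2.
    by congr (_, _); lra.
  have pv : p != v by apply: contraTneq e => ->; rewrite edge_irrefl.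
  apply: (generic y w p v _ _ yw pv _).
    rewrite inE mem_cat; apply/orP; right; apply/orP; left.
    exact: (codom_f (fun x : G * G * G =>
      cross (f x.1.1 - f x.2) (f x.1.2 - f x.1.1)) ((v, p), x)).
  rewrite /cross /csim /= in e1 e2 *.
  have -> : m.1 * ((g y).1 - (g w).1) - m.2 * ((g y).2 - (g w).2) =
    (f v).1 - (f x).1 + t * ((f p).1 - (f v).1) by lra.
  have -> : m.2 * ((g y).1 - (g w).1) + m.1 * ((g y).2 - (g w).2) =
    (f v).2 - (f x).2 + t * ((f p).2 - (f v).2) by lra.
  by ring.
Qed.

Lemma economical_prod_drawing : has_edge G -> has_edge H ->
  exists h : G □ H -> R * R, [/\ degenerate_drawing h,
    drawing f -> drawing g -> drawing h &
    (size (edge_lengths h) <=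
      size (edge_lengths f) + size (edge_lengths g) - 1)%N].
Proof.
move=> [v [p vp]] [w [q wq]].
have length_gt0 (K : sgraph) (k : K -> R * R) (a b : K) :
    injective k -> edge a b -> 0 < eucl_dist (k a) (k b).
  move=> k_inj ab; apply: eucl_dist_gt0; rewrite (inj_eq k_inj).
  by apply: contraTneq ab => ->; rewrite edge_irrefl.
have lf := length_gt0 _ _ _ _ f_inj vp.
have lg := length_gt0 _ _ _ _ g_inj wq.
(* This ratio scales the edge [w q] of [g] to the length of the edge [v p] of [f]. *)
pose r := eucl_dist (f v) (f p) / eucl_dist (g w) (g q).
have r_gt0 : 0 < r by rewrite divr_gt0.
have [m [mr hi hd]] := generic_prod_placement (lt0r_neq0 r_gt0).
exists (prod_placement m); split=> //.
pose l := eucl_dist (f v) (f p).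
pose S := [seq r * x | x <- edge_lengths g].
have l_f : l \in edge_lengths f by apply/edge_lengthsP; exists v, p.
have l_S : l \in S.
  apply/mapP; exists (eucl_dist (g w) (g q)); last by rewrite divfK ?gt_eqF.
  by apply/edge_lengthsP; exists w, q.
have size_S : size S = size (edge_lengths g) by rewrite size_map.
have S_gt0 : (0 < size S)%N by case: (S) l_S.
(* The shared length [l] is already counted for [f], so one occurrence is removed from [S]; as [S]
   is nonempty, the subtraction does not truncate. *)
rewrite -size_S -addnBA // subn1 -(size_rem l_S) -size_cat.
apply: uniq_leq_size => [|x]; first exact: undup_uniq.
move=> /(edge_lengths_prod_placement (ltW r_gt0) mr); rewrite !mem_cat.
case/orP => [->//|xS]; have [->|xl] := eqVneq x l; first by rewrite l_f.
by move: xS; rewrite (perm_mem (perm_to_rem l_S)) inE (negPf xl) /= => ->;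
   rewrite orbT.
Qed.

End ProductDrawing.
End DistanceNumbers.

Local Close Scope ring_scope.

(** The upper bounds need an edge on both sides: if [G] is edgeless and only [H] has an edge, the
    right side is one less than the distance-number of [H], contradicting the lower bound. The lower
    bounds need vertices, since a product with an empty factor is empty. *)
Theorem theorem24 (R : realType) (G H : sgraph)
    (G_nonempty : 0 < #|G|) (H_nonempty : 0 < #|H|) :
  (maxn (dn' R G) (dn' R H) <= dn' R (G □ H) /\
   (has_edge G -> has_edge H ->
      dn' R (G □ H) <= dn' R G + dn' R H - 1)) /\
  (maxn (dn R G) (dn R H) <= dn R (G □ H) /\
   (has_edge G -> has_edge H ->
      dn R (G □ H) <= dn R G + dn R H - 1)).
Proof.
(* The base vertices [v0] and [w0] select one copy of [H] and one copy of [G] in the product. *)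
have /card_gt0P[v0 _] := G_nonempty; have /card_gt0P[w0 _] := H_nonempty.
have injl : injective (fun v : G => (v, w0) : G □ H) by move=> u v [].
have injr : injective (fun w : H => (v0, w) : G □ H) by move=> u v [].
have edgel := @cart_edgel G H w0; have edger := @cart_edger G H v0.
rewrite !geq_max; split; split.
- by rewrite (dn'_embedding R injl edgel) (dn'_embedding R injr edger).
- move=> eG eH; have [f fi <-] := dn'_attained R G.
  have [g gi <-] := dn'_attained R H.
  have [h [hi _]] := economical_prod_drawing fi gi eG eH.
  exact/leq_trans/dn'_le.
- by rewrite (dn_embedding R injl edgel) (dn_embedding R injr edger).
- move=> eG eH; have [f fd <-] := dn_attained R G.
  have [g gd <-] := dn_attained R H.
  have [h [_ hd]] := economical_prod_drawing fd.1 gd.1 eG eH.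
  exact/leq_trans/dn_le/hd.
Qed.
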